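(* Let $t,q$ be positive integers, let $k=tq$ and $n=k+k^2$. Suppose that $(Q_i,*_i)$, $i=1,2,\ldots,t$, are pairwise disjoint left unitary $k$-translatable semigroups of cardinality $n$, where $Q_i$ has ordering $i_1,i_2,\ldots,i_n$. Let $Q=\bigcup_{i=1}^t Q_i$ be ordered so that $i_r$ is the $(t(r-1)+i)$-th element, i.e. identify $i_r=t(r-1)+i\in\{1,\ldots,tn\}$. Then $Q$ with this ordering is a left unitary $(k+(t-1)n)$-translatable semigroup with respect to the product $*$ defined by $$i_r*j_s=j_x,\quad\text{where } x=[k-kr+kq(i-1)+s]_n,$$ in which each $(Q_i,* )$ is isomorphic to $(Q_i,*_i)$. Furthermore, if on $Q=\bigcup_{i=1}^t Q_i$ a product $*$ is defined by the formula above, then $Q$ can be ordered in such a way that $(Q,* )$ becomes a left unitary $(k+(t-1)n)$-translatable semigroup in which each $(Q_i,* )$ is isomorphic to $(Q_i,*_i)$.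
   Context: A groupoid is a set with a binary operation; a semigroup is an associative groupoid. For integers $x$ and $N\ge1$, $[x]_N$ denotes the residue of $x$ modulo $N$, represented in $\{1,\ldots,N\}$, with $0$ identified with $N$. For $1\le \kappa<N$, a groupoid $(G,\circ)$ of order $N$ is $\kappa$-translatable with respect to an ordering $g_1,\ldots,g_N$ of its elements if in its multiplication table each row is obtained from the preceding one by cyclically shifting it $\kappa$ places to the right, i.e. $g_u\circ g_v=g_{u-1}\circ g_{[v-\kappa]_N}$ for all $v$ and all $2\le u\le N$. It is left unitary (with respect to this ordering) if $g_1$ is a left neutral element, i.e. $g_1\circ x=x$ for all $x$. ''Left unitary $\kappa$-translatable semigroup'' means both properties hold with respect to the same ordering. *)

(* Defs.v *)
From mathcomp Require Import all_boot all_order all_algebra.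
From mathcomp Require Import all_classical.
Set Implicit Arguments.
Unset Strict Implicit.
Unset Printing Implicit Defensive.
Import Order.TTheory GRing.Theory Num.Theory.
Local Open Scope classical_set_scope.
Local Open Scope ring_scope.

Definition idx (N : nat) : set nat := [set r | (1 <= r <= N)%N].

(* The residue of x modulo N taken in {1, ..., N}, so that 0 becomes N. *)
Definition res (N : nat) (x : int) : nat :=
  let r := `|(x %% N%:Z)%Z|%N in if r == 0%N then N else r.

(* A groupoid is given by a carrier A, a subset of an ambient type T, and a
   function op on T of which only the restriction to A is relevant. *)
Definition groupoid (T : Type) (A : set T) (op : T -> T -> T) : Prop :=
  forall x y, A x -> A y -> A (op x y).

Definition semigroup (T : Type) (A : set T) (op : T -> T -> T) : Prop :=
  groupoid A op /\
  forall x y z, A x -> A y -> A z -> op (op x y) z = op x (op y z).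

Definition isomorphic (T : Type) (A : set T) (opA : T -> T -> T)
    (B : set T) (opB : T -> T -> T) : Prop :=
  [/\ groupoid A opA, groupoid B opB &
    exists2 f : T -> T, set_bij A B f &
      forall x y, A x -> A y -> f (opA x y) = opB (f x) (f y)].

(* g lists A as g 1, ..., g N; its values outside {1, ..., N} are irrelevant. *)
Definition ordering (T : Type) (A : set T) (N : nat) (g : nat -> T) : Prop :=
  set_bij (idx N) A g.

Definition translatable (T : Type) (A : set T) (op : T -> T -> T)
    (N kappa : nat) (g : nat -> T) : Prop :=
  [/\ (1 <= kappa < N)%N, groupoid A op, ordering A N g &
    forall u v : nat, (2 <= u <= N)%N -> idx N v ->
      op (g u) (g v) = op (g (u - 1)%N) (g (res N (v%:Z - kappa%:Z)))].

Definition left_unitary (T : Type) (A : set T) (op : T -> T -> T)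
    (g : nat -> T) : Prop :=
  forall x, A x -> op (g 1%N) x = x.

Definition left_unitary_translatable_semigroup (T : Type) (A : set T)
    (op : T -> T -> T) (N kappa : nat) (g : nat -> T) : Prop :=
  [/\ semigroup A op, translatable A op N kappa g & left_unitary A op g].

(* Here g i r stands for the element i_r. *)
Definition product_formula (T : Type) (t q k n : nat) (g : nat -> nat -> T)
    (mul : T -> T -> T) : Prop :=
  forall i j r s : nat, idx t i -> idx t j -> idx n r -> idx n s ->
    mul (g i r) (g j s) =
    g j (res n (k%:Z - k%:Z * r%:Z + k%:Z * q%:Z * (i%:Z - 1) + s%:Z)).

Definition interleaved (T : Type) (t n : nat) (g : nat -> nat -> T)
    (h : nat -> T) : Prop :=
  forall i r : nat, idx t i -> idx n r -> h (t * (r - 1) + i)%N = g i r.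

(* Main.v *)
Require Import Defs.
From mathcomp Require Import all_boot all_order all_algebra.
From mathcomp Require Import all_classical.
From mathcomp Require Import zify ring.
Set Implicit Arguments.
Unset Strict Implicit.
Unset Printing Implicit Defensive.
Import Order.TTheory GRing.Theory Num.Theory.
Local Open Scope classical_set_scope.
Local Open Scope ring_scope.

(** Extend every ordering g of length N to a function on the integers that is
    periodic of period N (cyc N g below). A left unitary kappa-translatable
    groupoid then obeys the rule g_x g_y = g_(kappa - kappa x + y) for all
    integers x and y (translatable_mul), and the product on the union is
    i_x * j_y = j_(k - k x + k q (i - 1) + y), again for all integers
    (product_formula_cyc). No reduction to {1, ..., n} is left, and each claim
    becomes a polynomial identity up to a multiple of the period.

    - Associativity (product_semigroup): both bracketings of i_a * j_b * l_c
      land in the l component, and their indices differ by a multiple of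
      k^2 + k = n.

    - Isomorphism (product_isomorphic): the shift i_x -> i_(x - q (i - 1))
      absorbs the extra term k q (i - 1), as the coefficient of the left factor
      is -k.

    - Translatability (product_translatable): the interleaved ordering
      satisfies h_(t (x - 1) + i) = i_x for every integer x. The shift
      k + (t - 1) n is congruent to k - n = - k^2 = - t q k modulo t n, so moving
      back by it keeps the component j and replaces y by y + q k. Going from
      row u to row u - 1 replaces i by i - 1, which costs exactly k q. When
      i = 1 it replaces 1_x by t_(x - 1) instead, which adds
      k + k q (t - 1) = k + k^2 - k q, so that together with q k the change is n.

    - The first element of the interleaved ordering is 1_1, and it acts on the
      left by k - k + 0 + y = y (product_left_unitary).

    The product itself exists because the components are disjoint and each
    ordering is injective, so that a pair of elements determines the indices
    in the formula (product_exists). *)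

(** * Periodic extension of an ordering *)

Lemma res_idx (N : nat) (x : int) : (0 < N)%N -> idx N (res N x).
Proof.
move=> N0; rewrite /idx /res /=.
have N0z : N%:Z != 0 by lia.
have := modz_ge0 x N0z; have := @ltz_pmod x N%:Z.
move: (x %% N%:Z)%Z => m; rewrite ltz_nat => /(_ N0).
by case: ifP; lia.
Qed.

Lemma res_shift (N : nat) (x : int) : (0 < N)%N ->
  exists c : int, (res N x)%:Z = x + c * N%:Z.
Proof.
move=> N0; have := divz_eq x N%:Z; rewrite /res.
have N0z : N%:Z != 0 by lia.
have := modz_ge0 x N0z.
move: (x %% N%:Z)%Z (x %/ N%:Z)%Z => m d.
move=> m0 ->; case: ifP => [/eqP m_eq0|_].
  by exists (1 - d); have -> : m = 0 by [lia]; ring.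
by exists (- d); rewrite gez0_abs //; ring.
Qed.

Lemma res_mod (N : nat) (x y c : int) : x = y + c * N%:Z -> res N x = res N y.
Proof. by move=> ->; rewrite /res addrC modzMDl. Qed.

Lemma res_id (N r : nat) : idx N r -> res N r%:Z = r.
Proof.
rewrite /idx /res /= => /andP[r1 rN]; rewrite modz_nat /=.
have [->|rN'] := eqVneq r N; first by rewrite modnn.
by rewrite modn_small; [case: ifP; lia|lia].
Qed.

(** The periodic extension of g to the integers, in which indices are added and
    multiplied without reduction to {1, ..., N}. *)
Definition cyc (T : Type) (N : nat) (g : nat -> T) (z : int) : T := g (res N z).

Lemma cyc_nat (T : Type) (N : nat) (g : nat -> T) (r : nat) :
  idx N r -> cyc N g r%:Z = g r.
Proof. by move=> /res_id; rewrite /cyc => ->. Qed.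

Lemma cyc_mod (T : Type) (N : nat) (g : nat -> T) (x y c : int) :
  x = y + c * N%:Z -> cyc N g x = cyc N g y.
Proof. by rewrite /cyc => /res_mod ->. Qed.

Lemma ordering_cyc (T : Type) (A : set T) (N : nat) (g : nat -> T) (z : int) :
  (0 < N)%N -> ordering A N g -> A (cyc N g z).
Proof. by move=> N0 [gA _ _]; apply/gA/res_idx. Qed.

Lemma ordering_cyc_surj (T : Type) (A : set T) (N : nat) (g : nat -> T) (x : T) :
  ordering A N g -> A x -> exists z, x = cyc N g z.
Proof. by move=> [_ _ gs] /gs[r rN <-]; exists r%:Z; rewrite cyc_nat. Qed.

Lemma ordering_cyc_inj (T : Type) (A : set T) (N : nat) (g : nat -> T) (x y : int) :
  (0 < N)%N -> ordering A N g -> cyc N g x = cyc N g y ->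
  exists c : int, x = y + c * N%:Z.
Proof.
move=> N0 [_ gi _] /gi e0.
have e : res N x = res N y by apply: e0; rewrite inE; exact: res_idx.
have [a ea] := res_shift x N0; have [b eb] := res_shift y N0.
by exists (b - a); move: ea eb; rewrite e; lia.
Qed.

(** Periodicity is what makes a shift of the indices a bijection of A, whose
    inverse is the opposite shift. Choice turns the rule on indices into a
    function on T. *)
Lemma shift_bij (T : Type) (A : set T) (N : nat) (g : nat -> T) (c : int) :
  (0 < N)%N -> ordering A N g ->
  exists2 f : T -> T, set_bij A A f & forall z, f (cyc N g z) = cyc N g (z + c).
Proof.
move=> N0 og.
have [f fP] : {f : T -> T & forall x z, x = cyc N g z -> f x = cyc N g (z + c)}.
  apply: (@choice _ _ (fun x y => forall z, x = cyc N g z -> y = cyc N g (z + c))).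
  move=> x; have [[w xw]|nx] := pselect (exists w, x = cyc N g w); last first.
    by exists x => z xz; case: nx; exists z.
  exists (cyc N g (w + c)) => z; rewrite xw => /(ordering_cyc_inj N0 og)[d ->].
  by apply: (@cyc_mod _ _ _ _ _ d); ring.
have fE z : f (cyc N g z) = cyc N g (z + c) by exact: fP.
exists f => //; split.
- move=> x /(ordering_cyc_surj og)[z ->] /=; rewrite fE; exact: ordering_cyc.
- move=> x y; rewrite !inE => /(ordering_cyc_surj og)[z ->].
  move=> /(ordering_cyc_surj og)[w ->]; rewrite !fE.
  move=> /(ordering_cyc_inj N0 og)[d e]; apply: (@cyc_mod _ _ _ _ _ d).
  by move: e; lia.
- move=> x /(ordering_cyc_surj og)[z ->]; exists (cyc N g (z - c)).
    exact: ordering_cyc.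
  by rewrite fE subrK.
Qed.

(** * Left unitary translatable groupoids *)

(** Row 1 of the table is the identity and each later row is the preceding one
    shifted by kappa, so row u + 1 is the identity shifted by kappa u. *)
Lemma translatable_mul (T : Type) (A : set T) (op : T -> T -> T) (N kappa : nat)
    (g : nat -> T) (x y : int) :
  translatable A op N kappa g -> left_unitary A op g ->
  op (cyc N g x) (cyc N g y) = cyc N g (kappa%:Z - kappa%:Z * x + y).
Proof.
move=> [/andP[k1 kN] _ og tr] lu.
have N0 : (0 < N)%N by lia.
suff H u : (u < N)%N -> forall z,
    op (g u.+1) (cyc N g z) = cyc N g (z - kappa%:Z * u%:Z).
  have := res_idx x N0; have [c] := res_shift x N0; rewrite {1}/cyc.
  case: (res N x) => [|u]; rewrite /idx //= => eu uN.
  rewrite H //; apply: (@cyc_mod _ _ _ _ _ (- kappa%:Z * c)).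
  have -> : u%:Z = x + c * N%:Z - 1 by lia.
  by ring.
elim: u => [|u IH] uN z.
  by rewrite lu ?mulr0 ?subr0 //; exact: ordering_cyc.
rewrite /cyc tr; [|by lia|exact: res_idx].
have [c ez] := res_shift z N0.
rewrite subn1 -/(cyc N g _) IH; last by lia.
apply: (@cyc_mod _ _ _ _ _ c); rewrite ez intS; ring.
Qed.

(** * The interleaved ordering *)

Lemma idx_interleave (t n i r : nat) :
  idx t i -> idx n r -> idx (t * n)%N (t * (r - 1) + i)%N.
Proof.
rewrite /idx /= => /andP[i1 it] /andP[r1 rn]; apply/andP; split; first exact: ltn_addl.
apply: (@leq_trans (t * (r - 1) + t)%N); first by rewrite leq_add2l.
by rewrite -mulnSr leq_mul2l subn1 prednK // rn orbT.
Qed.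

(** The identification of i_r with position t (r - 1) + i holds for all integer
    indices: a period n of the component is t positions per step, hence a
    period t n of the interleaving. *)
Lemma interleaved_cyc (T : Type) (t n : nat) (g : nat -> nat -> T) (h : nat -> T)
    (i : nat) (x : int) :
  (0 < n)%N -> interleaved t n g h -> idx t i ->
  cyc (t * n) h (t%:Z * (x - 1) + i%:Z) = cyc n (g i) x.
Proof.
move=> n0 hE it; have rn := res_idx x n0; have [c ec] := res_shift x n0.
rewrite [RHS]/cyc -hE // -(cyc_nat _ (idx_interleave it rn)).
apply: (@cyc_mod _ _ _ _ _ (- c)).
rewrite PoszD !PoszM -subzn; last by case/andP: rn.
by rewrite ec; ring.
Qed.

Lemma int_interleave (t : nat) (z : int) : (0 < t)%N ->
  exists x : int, exists2 i : nat, idx t i & z = t%:Z * (x - 1) + i%:Z.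
Proof.
move=> t0; have [c ec] := res_shift z t0.
exists (1 - c), (res t z); first exact: res_idx.
by rewrite ec; ring.
Qed.

Lemma ordering_interleaved (T : Type) (t n : nat) (Q : nat -> set T)
    (g : nat -> nat -> T) (h : nat -> T) :
  (0 < t)%N -> (0 < n)%N -> trivIset (idx t) Q ->
  (forall i, idx t i -> ordering (Q i) n (g i)) -> interleaved t n g h ->
  ordering (\bigcup_(i in idx t) Q i) (t * n) h.
Proof.
move=> t0 n0 Qdisj og hE.
have dec m : idx (t * n)%N m -> exists i x,
    [/\ idx t i, m%:Z = t%:Z * (x - 1) + i%:Z & h m = cyc n (g i) x].
  move=> mN; have [x [i it e]] := int_interleave m%:Z t0.
  by exists i, x; split=> //; rewrite -(interleaved_cyc _ n0 hE it) -e cyc_nat.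
split.
- by move=> m /dec[i [x [it _ ->]]]; exists i => //; apply: ordering_cyc (og i it).
- move=> m m'; rewrite !inE => mN m'N.
  have [i [x [it em ->]]] := dec _ mN; have [j [y [jt em' ->]]] := dec _ m'N.
  move=> e; have eij : i = j.
    apply: Qdisj => //; exists (cyc n (g i) x).
    by split; [|rewrite e]; apply: ordering_cyc (og _ _).
  move: e em'; rewrite -{}eij => /(ordering_cyc_inj n0 (og i it))[c ec] em'.
  rewrite -(res_id mN) -(res_id m'N); apply: (@res_mod _ _ _ c).
  by rewrite em em' ec PoszM; ring.
- move=> x [i it Qx]; have [_ _ /(_ x Qx)[r rn <-]] := og i it.
  by exists (t * (r - 1) + i)%N; [exact: idx_interleave|exact: hE].
Qed.

Lemma interleaved_exists (T : Type) (t n : nat) (g : nat -> nat -> T) :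
  exists h, interleaved t n g h.
Proof.
exists (fun m => g (res t m%:Z) ((m - res t m%:Z) %/ t).+1) => i r it rn.
have -> : res t (t * (r - 1) + i)%N%:Z = i.
  by rewrite -[RHS](res_id it); apply: (@res_mod _ _ _ (r - 1)%N%:Z); lia.
move: it rn; rewrite /idx /= => it rn.
by rewrite addnK mulKn; [congr g; lia|lia].
Qed.

(** * The product on the union *)

(** The right-hand index depends on x and y only modulo n, so the formula
    passes to the periodic extensions. *)
Lemma product_formula_cyc (T : Type) (t q k n : nat) (g : nat -> nat -> T)
    (mul : T -> T -> T) (i j : nat) (x y : int) :
  (0 < n)%N -> product_formula t q k n g mul -> idx t i -> idx t j ->
  mul (cyc n (g i) x) (cyc n (g j) y) =
  cyc n (g j) (k%:Z - k%:Z * x + k%:Z * q%:Z * (i%:Z - 1) + y).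
Proof.
move=> n0 mulE it jt; rewrite {1 2}/cyc mulE //; try exact: res_idx.
rewrite -/(cyc n (g j) _).
have [a ->] := res_shift x n0; have [b ->] := res_shift y n0.
by apply: (@cyc_mod _ _ _ _ _ (b - k%:Z * a)); ring.
Qed.

(** The formula is consistent as a rule on elements, because a pair of elements
    of the union determines i, j, r and s; choice makes it a total operation. *)
Lemma product_exists (T : Type) (t q k n : nat) (Q : nat -> set T)
    (g : nat -> nat -> T) :
  trivIset (idx t) Q -> (forall i, idx t i -> ordering (Q i) n (g i)) ->
  exists mul, product_formula t q k n g mul.
Proof.
move=> Qdisj og.
have g_inj i j r s : idx t i -> idx t j -> idx n r -> idx n s ->
    g i r = g j s -> i = j /\ r = s.
  move=> it jt rn sn e.
  have [gQ gi _] := og i it; have [gQ' _ _] := og j jt.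
  have eij : i = j.
    by apply: Qdisj => //; exists (g i r); split; [exact: gQ|rewrite e; exact: gQ'].
  by split=> //; move: e; rewrite -eij; apply: gi; rewrite inE.
pose P (xy : T * T) z := forall i j r s : nat,
  idx t i -> idx t j -> idx n r -> idx n s -> xy = (g i r, g j s) ->
  z = g j (res n (k%:Z - k%:Z * r%:Z + k%:Z * q%:Z * (i%:Z - 1) + s%:Z)).
have [f fP] : {f & forall xy, P xy (f xy)}.
  apply: choice => xy.
  have [[i [j [r [s [it jt rn sn e]]]]]|nxy] := pselect (exists i j r s,
      [/\ idx t i, idx t j, idx n r, idx n s & xy = (g i r, g j s)]).
    exists (g j (res n (k%:Z - k%:Z * r%:Z + k%:Z * q%:Z * (i%:Z - 1) + s%:Z))).
    move=> i' j' r' s' it' jt' rn' sn'; rewrite e => -[e1 e2].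
    have [<- <-] := g_inj _ _ _ _ it it' rn rn' e1.
    by have [<- <-] := g_inj _ _ _ _ jt jt' sn sn' e2.
  by exists xy.1 => i j r s it jt rn sn e; case: nxy; exists i, j, r, s.
by exists (fun x y => f (x, y)) => i j r s it jt rn sn; apply: fP.
Qed.

(** The product adds the constant k q (i - 1) to the index of op i. Shifting all
    indices by c changes the index k - k x + y by - k c on the left factor, so
    c = - q (i - 1) removes that constant. *)
Lemma product_isomorphic (T : Type) (t q k n : nat) (A : set T)
    (op : T -> T -> T) (g : nat -> nat -> T) (mul : T -> T -> T) (i : nat) :
  left_unitary_translatable_semigroup A op n k (g i) ->
  product_formula t q k n g mul -> idx t i -> isomorphic A mul A op.
Proof.
move=> [[opA _] tr lu] mulE it; have [/andP[k1 kn] _ og _] := tr.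
have n0 : (0 < n)%N by lia.
split=> //.
  move=> x y /(ordering_cyc_surj og)[a ->] /(ordering_cyc_surj og)[b ->].
  by rewrite (product_formula_cyc _ _ n0 mulE it it); exact: ordering_cyc.
have [f fb fE] := shift_bij (- (q%:Z * (i%:Z - 1))) n0 og.
exists f => // x y /(ordering_cyc_surj og)[a ->] /(ordering_cyc_surj og)[b ->].
rewrite (product_formula_cyc _ _ n0 mulE it it) !fE (translatable_mul _ _ tr lu).
by congr cyc; ring.
Qed.

(** For (i_a * j_b) * l_c the inner index is multiplied by - k, and
    k^2 = - k modulo n turns the result into the index of i_a * (j_b * l_c). *)
Lemma product_semigroup (T : Type) (t q k n : nat) (Q : nat -> set T)
    (g : nat -> nat -> T) (mul : T -> T -> T) :
  n = (k + k ^ 2)%N -> (0 < n)%N ->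
  (forall i, idx t i -> ordering (Q i) n (g i)) ->
  product_formula t q k n g mul -> semigroup (\bigcup_(i in idx t) Q i) mul.
Proof.
move=> hn n0 og mulE.
have surj x : (\bigcup_(i in idx t) Q i) x ->
    exists2 i, idx t i & exists a, x = cyc n (g i) a.
  by move=> [i it /(ordering_cyc_surj (og i it))[a ->]]; exists i => //; exists a.
have mulC := product_formula_cyc _ _ n0 mulE.
split.
  move=> x y /surj[i it [a ->]] /surj[j jt [b ->]]; rewrite mulC //.
  by exists j => //; apply: ordering_cyc (og j jt).
move=> x y z /surj[i it [a ->]] /surj[j jt [b ->]] /surj[l lt [c ->]].
rewrite !mulC //.
(* The difference of the two indices is (k + k^2)(a - 1 - q (i - 1)). *)
apply: (@cyc_mod _ _ _ _ _ (a - 1 - q%:Z * (i%:Z - 1))).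
rewrite hn PoszD -mulnn PoszM; ring.
Qed.

(** Passing to the preceding row lowers the component i of the left factor by
    one, wrapping from 1 to t with the next lower index; both moves change the
    index of the product by - q k modulo n, which the column shift undoes. *)
Lemma product_translatable (T : Type) (t q k n : nat) (Q : nat -> set T)
    (g : nat -> nat -> T) (mul : T -> T -> T) (h : nat -> T) :
  (0 < t)%N -> (0 < q)%N -> k = (t * q)%N -> n = (k + k ^ 2)%N ->
  trivIset (idx t) Q -> (forall i, idx t i -> ordering (Q i) n (g i)) ->
  groupoid (\bigcup_(i in idx t) Q i) mul ->
  product_formula t q k n g mul -> interleaved t n g h ->
  translatable (\bigcup_(i in idx t) Q i) mul (t * n) (k + (t - 1) * n) h.
Proof.
move=> t0 q0 hk hn Qdisj og clo mulE hE.
have k0 : (0 < k)%N by rewrite hk muln_gt0 t0.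
have kn : (k < n)%N by rewrite hn -mulnn; nia.
have n0 : (0 < n)%N by lia.
have mulC := product_formula_cyc _ _ n0 mulE.
have hC := interleaved_cyc _ n0 hE.
split=> //.
- by case: (t) t0 => // t' _; rewrite subn1 /= mulSn; lia.
- exact: (ordering_interleaved t0 n0 Qdisj og hE).
move=> u v /andP[u2 uN] vN.
have uN' : idx (t * n)%N u by rewrite /idx /=; lia.
have uN'' : idx (t * n)%N (u - 1)%N by rewrite /idx /=; lia.
rewrite -(cyc_nat h uN') -(cyc_nat h vN) -(cyc_nat h uN'') -/(cyc _ h _).
have [x [i it eu]] := int_interleave u%:Z t0.
have [y [j jt ev]] := int_interleave v%:Z t0.
have -> : (u - 1)%N%:Z = u%:Z - 1 by lia.
have kz : k%:Z = t%:Z * q%:Z by rewrite hk PoszM.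
have nz : n%:Z = k%:Z + k%:Z * k%:Z by rewrite hn -mulnn PoszD PoszM.
(* - (k + (t - 1) n) = t q k - t n, since n - k = k^2 = t q k. *)
have -> : cyc (t * n)%N h (v%:Z - (k + (t - 1) * n)%N%:Z) =
    cyc n (g j) (y + q%:Z * k%:Z).
  rewrite -(hC j) //; apply: (@cyc_mod _ _ _ _ _ (-1)).
  rewrite ev PoszD !PoszM -subzn // nz kz; ring.
rewrite eu ev !hC // mulC //.
have [i1|i1] := eqVneq i 1%N.
  have -> : t%:Z * (x - 1) + i%:Z - 1 = t%:Z * (x - 1 - 1) + t%:Z.
    by rewrite i1; ring.
  have tt : idx t t by rewrite /idx /=; lia.
  rewrite hC // mulC //.
  (* The wrap adds k + k q (t - 1), the column shift adds q k: n in all. *)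
  apply: (@cyc_mod _ _ _ _ _ (-1)); rewrite i1 nz kz; ring.
have im : idx t (i - 1)%N by move: it i1; rewrite /idx /=; lia.
have -> : t%:Z * (x - 1) + i%:Z - 1 = t%:Z * (x - 1) + (i - 1)%N%:Z.
  by move: it; rewrite /idx /=; lia.
rewrite hC // mulC //; congr cyc.
rewrite -subzn; last by case/andP: it.
ring.
Qed.

Lemma product_left_unitary (T : Type) (t q k n : nat) (Q : nat -> set T)
    (g : nat -> nat -> T) (mul : T -> T -> T) (h : nat -> T) :
  (0 < t)%N -> (0 < n)%N ->
  (forall i, idx t i -> ordering (Q i) n (g i)) ->
  product_formula t q k n g mul -> interleaved t n g h ->
  left_unitary (\bigcup_(i in idx t) Q i) mul h.
Proof.
move=> t0 n0 og mulE hE _ [j jt /(ordering_cyc_surj (og j jt))[a ->]].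
have i1 : idx t 1%N by rewrite /idx /=; lia.
have r1 : idx n 1%N by rewrite /idx /=; lia.
have -> : h 1%N = g 1%N 1%N by rewrite -hE // subnn muln0.
rewrite -(cyc_nat (g 1%N) r1) (product_formula_cyc _ _ n0 mulE i1 jt).
by congr cyc; ring.
Qed.

Theorem theorem6p3 (t q k n : nat) (ht : (0 < t)%N) (hq : (0 < q)%N)
    (hk : k = (t * q)%N) (hn : n = (k + k ^ 2)%N)
    (T : Type) (Q : nat -> set T) (op : nat -> T -> T -> T)
    (g : nat -> nat -> T)
    (Qdisj : trivIset (idx t) Q)
    (QS : forall i : nat, idx t i ->
       left_unitary_translatable_semigroup (Q i) (op i) n k (g i)) :
  [/\ (exists mul : T -> T -> T, product_formula t q k n g mul),
      (exists h : nat -> T, interleaved t n g h),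
      (forall (mul : T -> T -> T) (h : nat -> T),
         product_formula t q k n g mul -> interleaved t n g h ->
         left_unitary_translatable_semigroup
           (\bigcup_(i in idx t) Q i) mul (t * n) (k + (t - 1) * n) h /\
         forall i : nat, idx t i -> isomorphic (Q i) mul (Q i) (op i))
    & (forall mul : T -> T -> T,
         product_formula t q k n g mul ->
         exists h : nat -> T,
           left_unitary_translatable_semigroup
             (\bigcup_(i in idx t) Q i) mul (t * n) (k + (t - 1) * n) h /\
           forall i : nat, idx t i -> isomorphic (Q i) mul (Q i) (op i))].
Proof.
have og i : idx t i -> ordering (Q i) n (g i) by case/QS => _ [].
have n0 : (0 < n)%N by rewrite hn hk addn_gt0 muln_gt0 ht hq.
have main mul h : product_formula t q k n g mul -> interleaved t n g h ->
    left_unitary_translatable_semigroup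
      (\bigcup_(i in idx t) Q i) mul (t * n) (k + (t - 1) * n) h /\
    forall i : nat, idx t i -> isomorphic (Q i) mul (Q i) (op i).
  move=> mulE hE; split; last first.
    by move=> i it; exact: (product_isomorphic (QS i it) mulE it).
  have sg : semigroup (\bigcup_(i in idx t) Q i) mul.
    exact: product_semigroup hn n0 og mulE.
  split=> //; last exact: product_left_unitary mulE hE.
  by case: sg => clo _; exact: product_translatable mulE hE.
have hex := interleaved_exists t n g.
split=> //; first exact: product_exists Qdisj og.
by move=> mul mulE; have [h hE] := hex; exists h; exact: main.
Qed.
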